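(* Let $X\subseteq\mathbb{R}^s$ be an open set, let $f=(f_1,\dots,f_n):X\to\mathbb{R}^n$ and $g=(g_1,\dots,g_m):X\to\mathbb{R}^m$ be Fréchet differentiable on $X$, let $S=\{x\in X\mid g(x)\leqq 0\}$, and consider the problem (P): minimize $f(x)$ subject to $x\in S$. Then the following two statements are equivalent: (i) for every Kuhn-Tucker stationary point $\bar x\in S$ and for every multiplier $(\bar\lambda,\bar\mu)$ which satisfies the Kuhn-Tucker necessary optimality conditions together with $\bar x$, the point $\bar x$ is the unique global solution of the weighting problem $(\mathrm{P}_{\bar\lambda})$ with the same vector $\bar\lambda$; (ii) (P) is strictly KT-invex.
   Context: For vectors $a,b$ of the same dimension: $a<b$ means $a_i<b_i$ for all $i$, and $a\leqq b$ means $a_i\le b_i$ for all $i$; $a>b$ and $a\geqq b$ are defined analogously. The Jacobian matrix of $f$ at $x$ is $Jf(x)$, an $n\times s$ matrix with rows $\nabla f_i(x)$; $\lambda f(x)=\sum_{i=1}^n\lambda_i f_i(x)$. For $x\in S$, $I(x)=\{i\in\{1,\dots,m\}\mid g_i(x)=0\}$ is the set of active constraints. Kuhn-Tucker necessary optimality conditions: a multiplier $(\bar\lambda,\bar\mu)\in\mathbb{R}^n\times\mathbb{R}^m$ satisfies them together with $\bar x\in S$ if $\bar\lambda\geqq 0$, $\bar\lambda\neq 0$, $\bar\mu\geqq 0$, $\bar\mu_i g_i(\bar x)=0$ for $i=1,\dots,m$, and $\sum_{i=1}^n\bar\lambda_i\nabla f_i(\bar x)+\sum_{i\in I(\bar x)}\bar\mu_i\nabla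 g_i(\bar x)=0$. A point $\bar x\in S$ is a Kuhn-Tucker stationary point (KT point) if such a multiplier exists. Weighting problem $(\mathrm{P}_\lambda)$, for $\lambda\geqq 0$, $\lambda\ne 0$: minimize $\lambda f(x)$ subject to $x\in S$. A point $\bar x\in S$ is its unique global solution if $\lambda f(\bar x)<\lambda f(x)$ for all $x\in S$, $x\neq\bar x$. Strictly KT-invex: (P) is strictly KT-invex if there exists a map $\eta:X\times X\to\mathbb{R}^s$ such that for all $x,y\in X$ with $y\neq x$, $g(x)\leqq 0$ and $g(y)\leqq 0$, one has $f(y)-f(x)>Jf(x)\,\eta(x,y)$ (componentwise strict inequality) and $0\ge\nabla g_j(x)\,\eta(x,y)$ for all $j\in I(x)$. *)

(* Defs.v *)
(* R^k is 'rV[R]_k for R : realType.  A map defined on an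
   open set X of R^s is a total function on 'rV[R]_s whose values outside X are
   irrelevant: differentiability and the Jacobian at a point of the open set X
   depend only on the values on X. *)
From mathcomp Require Import all_boot all_order all_algebra.
From mathcomp Require Import all_classical all_reals all_analysis.

Set Implicit Arguments.
Unset Strict Implicit.
Unset Printing Implicit Defensive.

Import Order.TTheory GRing.Theory Num.Theory.
Import numFieldNormedType.Exports.

Local Open Scope classical_set_scope.
Local Open Scope ring_scope.

Definition vlt (R : realType) (k : nat) (a b : 'rV[R]_k) : Prop :=
  forall i : 'I_k, a 0 i < b 0 i.

Definition vle (R : realType) (k : nat) (a b : 'rV[R]_k) : Prop :=
  forall i : 'I_k, a 0 i <= b 0 i.

Definition dot (R : realType) (k : nat) (a b : 'rV[R]_k) : R :=
  \sum_(i < k) a 0 i * b 0 i.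

(* The library's 'J h x is the s x k matrix acting on row vectors by
   v |-> v *m 'J h x; its transpose is the usual k x s Jacobian matrix. *)
Definition Jac (R : realType) (s k : nat) (h : 'rV[R]_s -> 'rV[R]_k)
    (x : 'rV[R]_s) : 'M[R]_(k, s) :=
  ('J h x)^T.

Definition grad (R : realType) (s k : nat) (h : 'rV[R]_s -> 'rV[R]_k)
    (i : 'I_k) (x : 'rV[R]_s) : 'rV[R]_s :=
  row i (Jac h x).

Definition feasible (R : realType) (s m : nat) (X : set 'rV[R]_s)
    (g : 'rV[R]_s -> 'rV[R]_m) : set 'rV[R]_s :=
  [set x | X x /\ vle (g x) 0].

Definition active (R : realType) (s m : nat) (g : 'rV[R]_s -> 'rV[R]_m)
    (x : 'rV[R]_s) : pred 'I_m :=
  [pred j | g x 0 j == 0].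

Definition KT_conditions (R : realType) (s n m : nat)
    (f : 'rV[R]_s -> 'rV[R]_n) (g : 'rV[R]_s -> 'rV[R]_m)
    (x : 'rV[R]_s) (lam : 'rV[R]_n) (mu : 'rV[R]_m) : Prop :=
  [/\ vle 0 lam, lam <> 0, vle 0 mu,
      forall j : 'I_m, mu 0 j * g x 0 j = 0
    & \sum_(i < n) lam 0 i *: grad f i x
      + \sum_(j in active g x) mu 0 j *: grad g j x = 0].

Definition KT_point (R : realType) (s n m : nat) (X : set 'rV[R]_s)
    (f : 'rV[R]_s -> 'rV[R]_n) (g : 'rV[R]_s -> 'rV[R]_m)
    (x : 'rV[R]_s) : Prop :=
  feasible X g x /\
  exists (lam : 'rV[R]_n) (mu : 'rV[R]_m), KT_conditions f g x lam mu.

Definition unique_global_solution (R : realType) (s : nat)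
    (phi : 'rV[R]_s -> R) (S : set 'rV[R]_s) (x : 'rV[R]_s) : Prop :=
  S x /\ forall y : 'rV[R]_s, S y -> y <> x -> phi x < phi y.

(* Vectors being rows, the product of Jac f x with the column eta(x, y) is
   written as the row (Jac f x *m (eta x y)^T)^T. *)
Definition strictly_KT_invex (R : realType) (s n m : nat) (X : set 'rV[R]_s)
    (f : 'rV[R]_s -> 'rV[R]_n) (g : 'rV[R]_s -> 'rV[R]_m) : Prop :=
  exists eta : 'rV[R]_s -> 'rV[R]_s -> 'rV[R]_s,
    forall x y : 'rV[R]_s, X x -> X y -> y <> x ->
      vle (g x) 0 -> vle (g y) 0 ->
      vlt (Jac f x *m (eta x y)^T)^T (f y - f x) /\
      (forall j : 'I_m, j \in active g x -> dot (grad g j x) (eta x y) <= 0).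

(* Main.v *)
Require Import Defs.
From mathcomp Require Import all_boot all_order all_algebra.
From mathcomp Require Import all_classical all_reals all_analysis.
From mathcomp Require Import ring lra.

Set Implicit Arguments.
Unset Strict Implicit.
Unset Printing Implicit Defensive.

Import Order.TTheory GRing.Theory Num.Theory.
Import numFieldNormedType.Exports.

Local Open Scope classical_set_scope.
Local Open Scope ring_scope.

(** The equivalence is linear-programming duality at each pair of feasible
    points [x <> y].  Strict KT-invexity asks, for the fixed data of the pair,
    for a vector [w] with [Jf(x) w < f(y) - f(x)] and [grad g_j(x) w <= 0] for
    the active [j].  By Motzkin's transposition theorem (lemma [motzkin]) such
    a [w] is missing exactly when there are [lam >= 0], [lam <> 0], and
    [mu >= 0] with [sum lam_i grad f_i(x) + sum mu_j grad g_j(x) = 0] and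
    [lam (f(y) - f(x)) <= 0]: that is, when [x] is a KT point with a multiplier
    whose weighting problem does not have [x] as a unique solution, because [y]
    does at least as well.

    So (i) rules out the dual certificate and yields [w] for every pair; the
    axiom of choice collects these vectors into the kernel [eta].  Conversely,
    given [eta], weighting its inequalities by a multiplier gives
    [lam (f(y) - f(x)) > lam Jf(x) eta = - sum mu_j grad g_j(x) eta >= 0].

    Motzkin's theorem is derived from Farkas' lemma for linear forms on an
    arbitrary vector space, which has an algebraic proof by induction on the
    number of forms (D. Bartl). *)

(** * Theorems of the alternative for linear forms *)

Section Alternative.
Variables (R : realFieldType) (W : lmodType R).

Lemma scalar0 (h : W -> R) : scalar h -> h 0 = 0.
Proof. by move=> hh; have := hh (-1) 0 0; rewrite scaler0 addr0 mulN1r addNr. Qed.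

Lemma scalar_scale (h : W -> R) (c : R) (w : W) :
  scalar h -> h (c *: w) = c * h w.
Proof. by move=> hh; rewrite -[c *: w]addr0 hh scalar0 // addr0. Qed.

(** Induction on [r].  If the head form [a i0] is really needed, some [z]
    satisfies the other inequalities but has [b z > 0], so [a i0 z > 0] and one
    may normalise to [a i0 z = 1].  Composing all forms with the projection
    [w |-> w - a i0 w *: z] onto the kernel of [a i0] eliminates [a i0], and the
    coefficient that [a i0] gets when the projection is undone is nonnegative
    because [b z > 0 >= a i z]. *)
Lemma farkas (I : eqType) (r : seq I) (a : I -> W -> R) (b : W -> R) :
  uniq r -> (forall i, scalar (a i)) -> scalar b ->
  (forall w, (forall i, i \in r -> a i w <= 0) -> b w <= 0) ->
  exists2 u : I -> R, (forall i, 0 <= u i)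
    & forall w, b w = \sum_(i <- r) u i * a i w.
Proof.
elim: r a b => [|i0 r IHr] a b /=.
  move=> _ _ bP cons; exists (fun=> 0) => // w; rewrite big_nil.
  have bw : b w <= 0 by apply: cons.
  have : b ((-1) *: w) <= 0 by apply: cons.
  rewrite scalar_scale //; lra.
case/andP=> i0r ur aP bP cons.
have [consr|] := pselect
    (forall w, (forall i, i \in r -> a i w <= 0) -> b w <= 0).
  have [u u0 ub] := IHr a b ur aP bP consr.
  exists (fun i => if i == i0 then 0 else u i) => [i|w]; first by case: eqP.
  rewrite big_cons eqxx mul0r add0r ub; apply: eq_big_seq => i ir.
  by case: eqP => // ii0; rewrite -ii0 ir in i0r.
move=> /existsNP[z0 /not_implyP[az0 /negP]]; rewrite -ltNge => bz0.
have a0z0 : 0 < a i0 z0.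
  rewrite ltNge; apply: contraTN bz0 => a0z0; rewrite -leNgt; apply: cons => i.
  by rewrite inE => /predU1P[->|/az0].
pose z := (a i0 z0)^-1 *: z0.
have a0z : a i0 z = 1 by rewrite scalar_scale // mulVf // gt_eqF.
have bz : 0 < b z by rewrite scalar_scale // mulr_gt0 // invr_gt0.
have az i : i \in r -> a i z <= 0.
  by move=> ir; rewrite scalar_scale // pmulr_rle0 ?invr_gt0 // az0.
pose proj (h : W -> R) w := h w - h z * a i0 w.
have projP h : scalar h -> scalar (proj h).
  by move=> hP c v w; rewrite /proj hP aP; ring.
have projE h w : scalar h -> h ((- a i0 w) *: z + w) = proj h w.
  by move=> ->; rewrite /proj; ring.
have [|||u u0 ub] := IHr (fun i => proj (a i)) (proj b) ur.
- by move=> i; apply: projP.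
- exact: projP.
- move=> w aw; rewrite -projE //; apply: cons => i; rewrite projE // inE.
  by move=> /predU1P[->|/aw //]; rewrite /proj a0z; lra.
pose c := b z - \sum_(i <- r) u i * a i z.
have c0 : 0 <= c.
  rewrite subr_ge0 (le_trans _ (ltW bz)) // big_seq sumr_le0 // => i ir.
  by rewrite mulr_ge0_le0 // az.
exists (fun i => if i == i0 then c else u i) => [i|w]; first by case: eqP.
rewrite big_cons eqxx (_ : \sum_(i <- r) _ = \sum_(i <- r) u i * a i w).
  have subz : \sum_(i <- r) u i * proj (a i) w =
      \sum_(i <- r) u i * a i w - (\sum_(i <- r) u i * a i z) * a i0 w.
    by rewrite mulr_suml -sumrB; apply: eq_bigr => i _; rewrite /proj; ring.
  by have := ub w; rewrite subz /proj /c; lra.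
apply: eq_big_seq => i ir.
by case: eqP => // ii0; rewrite -ii0 ir in i0r.
Qed.

End Alternative.

(** Homogenise with two extra coordinates: a scale [t] and a slack [e].  If
    [p_i w + e <= t c_i], [q_j w <= 0] and [e <= t] with [e > 0], then [t > 0]
    and [w / t] solves the strict system.  So insolvability says that these
    homogeneous inequalities imply [e <= 0], and Farkas' lemma writes the form
    [e] as a nonnegative combination of theirs.  Comparing the coefficients of
    [w], [t] and [e] gives the three conclusions; [lam = 0] is impossible since
    then both [nu = 0] (from [t]) and [nu = 1] (from [e]), where [nu] is the
    coefficient of [e - t]. *)
Lemma motzkin (R : realFieldType) (W : lmodType R) (I J : finType)
    (p : I -> W -> R) (c : I -> R) (q : J -> W -> R) :
  (forall i, scalar (p i)) -> (forall j, scalar (q j)) ->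
  ~ (exists w, (forall i, p i w < c i) /\ (forall j, q j w <= 0)) ->
  exists (lam : I -> R) (mu : J -> R),
    [/\ forall i, 0 <= lam i, exists i, lam i != 0, forall j, 0 <= mu j,
        forall w, \sum_i lam i * p i w + \sum_j mu j * q j w = 0
      & \sum_i lam i * c i <= 0].
Proof.
move=> pP qP nosol.
pose a (k : I + J + unit) (v : W * R^o * R^o) : R :=
  match k with
  | inl (inl i) => p i v.1.1 + v.2 - v.1.2 * c i
  | inl (inr j) => q j v.1.1
  | inr _ => v.2 - v.1.2
  end.
have aP k : scalar (a k).
  case: k => [[i|j]|u] d [[w t] e] [[w' t'] e'] /=.
  - by rewrite pP /GRing.scale /=; ring.
  - by rewrite qP.
  - by rewrite /GRing.scale /=; ring.
have [//||u u0 uE] :=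
    @farkas R _ _ (index_enum _) a (fun v => v.2) (index_enum_uniq _) aP.
- move=> [[w t] e] av /=; rewrite leNgt; apply/negP => e0; apply: nosol.
  have et : e <= t.
    by have := av (inr tt) (mem_index_enum _); rewrite /= subr_le0.
  have t0 : 0 < t by apply: lt_le_trans et.
  exists (t^-1 *: w); split=> [i|j].
    have /= := av (inl (inl i)) (mem_index_enum _).
    by rewrite (scalar_scale _ _ (pP i)) ltr_pdivrMl // => ?; lra.
  have /= := av (inl (inr j)) (mem_index_enum _).
  by rewrite (scalar_scale _ _ (qP j)) pmulr_rle0 ?invr_gt0.
have {}uE w t e : e = \sum_i u (inl (inl i)) * (p i w + e - t * c i)
    + \sum_j u (inl (inr j)) * q j w + u (inr tt) * (e - t).
  have /= := uE (w, t, e); rewrite !big_sumType /= => {1}->.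
  by congr (_ + _); rewrite (big_pred1 tt) // => -[].
pose lam i := u (inl (inl i)); pose mu j := u (inl (inr j)).
exists lam, mu.
have q0 : \sum_j mu j * q j 0 = 0.
  by rewrite big1 // => j _; rewrite scalar0 // mulr0.
have coef_t : \sum_i lam i * c i = - u (inr tt).
  have := uE 0 (-1) 0; rewrite q0 addr0 sub0r opprK mulr1.
  rewrite (eq_bigr (fun i => lam i * c i)) => [|i _]; first by move=> ?; lra.
  by rewrite scalar0 // !add0r mulN1r opprK.
split.
- by move=> i; apply: u0.
- have [//|/forallNP lam0] := pselect (exists i, lam i != 0).
  have lamz i : lam i = 0 by apply/eqP/negPn/negP/lam0.
  have nu0 : u (inr tt) = 0.
    move: coef_t; rewrite big1 => [?|i _]; last by rewrite lamz mul0r.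
    lra.
  have := uE 0 0 1; rewrite q0 nu0 big1 => [?|i _]; first lra.
  by rewrite -/(lam i) lamz mul0r.
- by move=> j; apply: u0.
- move=> w; have := uE w 0 0; rewrite subrr mulr0 addr0 => /esym.
  by under eq_bigr do rewrite addr0 mul0r subr0.
- by rewrite coef_t oppr_le0.
Qed.

(** * The dot product and the Jacobian *)

Section Dot.
Variables (R : realType) (k : nat).
Implicit Types v w : 'rV[R]_k.

Lemma dot_scalar v : scalar (dot v).
Proof.
move=> d w w'; rewrite /dot mulr_sumr -big_split; apply: eq_bigr => i _.
by rewrite !mxE /=; ring.
Qed.

Lemma dotC v w : dot v w = dot w v.
Proof. by apply: eq_bigr => i _; rewrite mulrC. Qed.

Lemma dot0l w : dot 0 w = 0.
Proof. by rewrite dotC (scalar0 (dot_scalar w)). Qed.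

Lemma dotDl v v' w : dot (v + v') w = dot v w + dot v' w.
Proof. by rewrite !(dotC _ w) -[v]scale1r dot_scalar mul1r scale1r. Qed.

Lemma dotBr v w w' : dot v (w - w') = dot v w - dot v w'.
Proof. by rewrite addrC -scaleN1r dot_scalar mulN1r addrC. Qed.

Lemma dot_suml (I : finType) (P : pred I) (l : I -> R) (v : I -> 'rV[R]_k) w :
  dot (\sum_(i | P i) l i *: v i) w = \sum_(i | P i) l i * dot (v i) w.
Proof.
rewrite (big_morph (fun v => dot v w) (fun v v' => dotDl v v' w) (dot0l w)).
by apply: eq_bigr => i _; rewrite dotC (scalar_scale _ _ (dot_scalar w)) dotC.
Qed.

Lemma dot_eq0 v : (forall w, dot v w = 0) -> v = 0.
Proof.
move=> v0; apply/rowP => i; rewrite mxE -(v0 (delta_mx 0 i)) /dot.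
rewrite (bigD1 i) //= big1 => [|j ji]; first by rewrite mxE !eqxx mulr1 addr0.
by rewrite mxE (negPf ji) andbF mulr0.
Qed.

End Dot.

Lemma Jac_mul (R : realType) (s k : nat) (h : 'rV[R]_s -> 'rV[R]_k)
    (x w : 'rV[R]_s) (i : 'I_k) :
  (Jac h x *m w^T)^T 0 i = dot (grad h i x) w.
Proof. by rewrite !mxE /dot; apply: eq_bigr => j _; rewrite !mxE. Qed.

(** * Strict KT-invexity and the weighting problems *)

(** The dual certificate for the pair [(x, y)] is a KT multiplier at [x] whose
    weighted objective is no worse at [y]. *)
Lemma KT_conditions_of_no_direction (R : realType) (s n m : nat)
    (f : 'rV[R]_s -> 'rV[R]_n) (g : 'rV[R]_s -> 'rV[R]_m)
    (x : 'rV[R]_s) (b : 'rV[R]_n) :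
  ~ (exists w, vlt (Jac f x *m w^T)^T b /\
       forall j, j \in active g x -> dot (grad g j x) w <= 0) ->
  exists (lam : 'rV[R]_n) (mu : 'rV[R]_m),
    KT_conditions f g x lam mu /\ dot lam b <= 0.
Proof.
move=> nosol.
(* Inactive constraints enter the system as the trivial form 0, and their
   multipliers are then set to 0 for complementary slackness. *)
pose q j := if j \in active g x then grad g j x else 0.
have [||[w [fw gw]]|lam [mu [lam0 [i0 lami0] mu0 stat lamb]]] :=
    @motzkin R 'rV[R]_s _ _ (fun i => dot (grad f i x)) (b 0)
      (fun j => dot (q j)).
- by move=> i; apply: dot_scalar.
- by move=> j; apply: dot_scalar.
- apply: nosol; exists w; split=> [i|j jx]; first by rewrite Jac_mul.
  by have := gw j; rewrite /q jx.
exists (\row_i lam i), (\row_j if j \in active g x then mu j else 0).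
split; last by rewrite /dot; under eq_bigr do rewrite mxE.
split.
- by move=> i; rewrite !mxE.
- by move=> /rowP/(_ i0); rewrite !mxE => /eqP; rewrite (negPf lami0).
- by move=> j; rewrite !mxE; case: ifP.
- move=> j; rewrite !mxE inE.
  by have [->|] := eqVneq (g x 0 j) 0; rewrite ?mulr0 ?mul0r.
apply: dot_eq0 => w; rewrite dotDl !dot_suml -[RHS](stat w); congr (_ + _).
  by apply: eq_bigr => i _; rewrite mxE.
rewrite big_mkcond; apply: eq_bigr => j _; rewrite /q mxE.
by case: (j \in active g x) => //; rewrite dot0l mulr0.
Qed.

(** Weighting the invexity inequalities by a multiplier, stationarity cancels
    the gradients of [f] against those of [g].  The inequality is strict since
    some [lam i] is positive. *)
Lemma dot_gt0_of_direction (R : realType) (s n m : nat)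
    (f : 'rV[R]_s -> 'rV[R]_n) (g : 'rV[R]_s -> 'rV[R]_m)
    (x w : 'rV[R]_s) (b lam : 'rV[R]_n) (mu : 'rV[R]_m) :
  KT_conditions f g x lam mu ->
  vlt (Jac f x *m w^T)^T b ->
  (forall j, j \in active g x -> dot (grad g j x) w <= 0) ->
  0 < dot lam b.
Proof.
move=> [lam0 lamN0 mu0 _ stat] fw gw.
have lam_ge0 i : 0 <= lam 0 i by have := lam0 i; rewrite mxE.
have mu_ge0 j : 0 <= mu 0 j by have := mu0 j; rewrite mxE.
have [i0 lami0] : exists i, lam 0 i != 0.
  have [//|/forallNP lamz] := pselect (exists i, lam 0 i != 0).
  by case: lamN0; apply/rowP => i; rewrite mxE; apply/eqP/negPn/negP/lamz.
have : dot 0 w = 0 by exact: dot0l.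
rewrite -{1}stat dotDl !dot_suml => statw.
have muw : \sum_(j in active g x) mu 0 j * dot (grad g j x) w <= 0.
  by apply: sumr_le0 => j jx; rewrite mulr_ge0_le0 // gw.
suff : \sum_i lam 0 i * dot (grad f i x) w < dot lam b by lra.
rewrite [ltRHS]/dot (bigD1 i0) //= [ltRHS](bigD1 i0) //=; apply: ltr_leD.
  by rewrite -Jac_mul ltr_pM2l ?fw // lt_def lami0 lam_ge0.
by apply: ler_sum => i _; rewrite ler_wpM2l // -Jac_mul; apply/ltW/fw.
Qed.

Theorem theorem3 (R : realType) (s n m : nat) (X : set 'rV[R]_s)
    (f : 'rV[R]_s -> 'rV[R]_n) (g : 'rV[R]_s -> 'rV[R]_m)
    (X_open : open X)
    (f_diff : forall x : 'rV[R]_s, X x -> differentiable f x)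
    (g_diff : forall x : 'rV[R]_s, X x -> differentiable g x) :
  (forall xbar : 'rV[R]_s, KT_point X f g xbar ->
     forall (lam : 'rV[R]_n) (mu : 'rV[R]_m),
       KT_conditions f g xbar lam mu ->
       unique_global_solution (fun x => dot lam (f x)) (feasible X g) xbar)
  <-> strictly_KT_invex X f g.
Proof.
split=> [uniq_sol|[eta etaP] x [[Xx gx] _] lam mu KT]; last first.
  split=> [//|y [Xy gy] yx].
  have [fw gw] := etaP x y Xx Xy yx gx gy.
  by rewrite -subr_gt0 -dotBr; apply: dot_gt0_of_direction KT fw gw.
have dir (xy : 'rV[R]_s * 'rV[R]_s) : exists w,
    X xy.1 -> X xy.2 -> xy.2 <> xy.1 -> vle (g xy.1) 0 -> vle (g xy.2) 0 ->
    vlt (Jac f xy.1 *m w^T)^T (f xy.2 - f xy.1) /\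
    forall j, j \in active g xy.1 -> dot (grad g j xy.1) w <= 0.
  case: xy => x y /=.
  have [[w wP]|/KT_conditions_of_no_direction[lam [mu [KT lamb]]]] := pselect
      (exists w, vlt (Jac f x *m w^T)^T (f y - f x) /\
         forall j, j \in active g x -> dot (grad g j x) w <= 0).
    by exists w.
  exists 0 => Xx Xy yx gx gy.
  have KTx : KT_point X f g x by split=> //; exists lam, mu.
  have [_ /(_ y (conj Xy gy) yx)] := uniq_sol x KTx lam mu KT.
  by rewrite -subr_gt0 -dotBr ltNge lamb.
have [eta etaP] := choice dir.
by exists (fun x y => eta (x, y)) => x y; apply: (etaP (x, y)).
Qed.
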